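(* Let $D,N\ge1$ be integers and $\eta>0$. Let $\mathcal{Y}$ be a finite nonempty set of outputs with embedding map $\mathrm{embed}:\mathcal{Y}\to\mathbb{R}^D$, let $W_{out}\in\mathbb{R}^{D\times D}$, and for $h\in\mathbb{R}^D$ let $$P(y\mid h)=\frac{\exp\big(h^\top W_{out}\,\mathrm{embed}(y)\big)}{\sum_{y'\in\mathcal{Y}}\exp\big(h^\top W_{out}\,\mathrm{embed}(y')\big)},\qquad y\in\mathcal{Y}.$$ Let $\bm{y}_1,\dots,\bm{y}_N\in\mathbb{R}^D$ be the embeddings of $N$ example outputs in $\mathcal{Y}$, let $r_1,\dots,r_N\in\mathbb{R}$ be their scores, and let $$\Delta h=\frac{\eta}{N}\sum_{i=1}^N r_i\,\bm{y}_i .$$ Let $h\in\mathbb{R}^D$, $\pi_{\mathrm{ref}}=P(\cdot\mid h)$ and $\pi_{ICL}=P(\cdot\mid h+\Delta h)$. Then $$D_{KL}(\pi_{ICL}\,\|\,\pi_{\mathrm{ref}})\le\frac12\,\Lambda_C\,(\eta\cdot r_{max}\cdot y_{max})^2,$$ where $\Lambda_C=\sup_{t\in[0,1]}\lambda_{\max}\big(F(h+t\Delta h)\big)$, $r_{max}=\max_{1\le i\le N}|r_i|$, and $y_{max}=\max_{1\le i\le N}\|\bm{y}_i\|$.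
   Context: $F(h)\in\mathbb{R}^{D\times D}$ is the Fisher information matrix of the output layer with respect to the hidden state: $$F(h)=\sum_{y\in\mathcal{Y}}P(y\mid h)\,\nabla_h\log P(y\mid h)\,\nabla_h\log P(y\mid h)^\top .$$ $\lambda_{\max}$ denotes the largest eigenvalue of a symmetric matrix, $\|\cdot\|$ is the Euclidean norm, and $D_{KL}(p\|q)=\sum_{y\in\mathcal{Y}}p(y)\log\frac{p(y)}{q(y)}$. *)

(* Defs.v *)
From HB Require Import structures.
From mathcomp Require Import all_boot all_order all_algebra.
From mathcomp Require Import all_classical all_reals all_analysis.

Set Implicit Arguments.
Unset Strict Implicit.
Unset Printing Implicit Defensive.

Import Order.TTheory GRing.Theory Num.Theory.
Import numFieldNormedType.Exports.

Local Open Scope classical_set_scope.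
Local Open Scope ring_scope.

(* The norm `|x| of mathcomp-analysis on matrices is the sup norm, so the
   Euclidean norm has to be defined separately. *)
Definition enorm (R : realType) (D : nat) (x : 'cV[R]_D) : R :=
  Num.sqrt (\sum_(j < D) x j 0 ^+ 2).

Definition gradient (R : realType) (D : nat) (f : 'cV[R]_D -> R)
    (h : 'cV[R]_D) : 'cV[R]_D :=
  \col_j 'D_(delta_mx j 0) f h.

(* A matrix of positive size has finitely many eigenvalues, and at least one of
   them is real if it is symmetric: the supremum is then a maximum. *)
Definition lambda_max (R : realType) (D : nat) (A : 'M[R]_D) : R :=
  sup [set a | eigenvalue A a].

Definition logit (R : realType) (D : nat) (Y : finType) (W : 'M[R]_D)
    (embed : Y -> 'cV[R]_D) (h : 'cV[R]_D) (y : Y) : R :=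
  (h^T *m W *m embed y) 0 0.

Definition policy (R : realType) (D : nat) (Y : finType) (W : 'M[R]_D)
    (embed : Y -> 'cV[R]_D) (h : 'cV[R]_D) (y : Y) : R :=
  expR (logit W embed h y) / \sum_(y' : Y) expR (logit W embed h y').

Definition fisher (R : realType) (D : nat) (Y : finType) (W : 'M[R]_D)
    (embed : Y -> 'cV[R]_D) (h : 'cV[R]_D) : 'M[R]_D :=
  \sum_(y : Y)
    let score := gradient (fun x => ln (policy W embed x y)) h in
    policy W embed h y *: (score *m score^T).

Definition KL (R : realType) (Y : finType) (p q : Y -> R) : R :=
  \sum_(y : Y) p y * ln (p y / q y).

(* Main.v *)
(* Write l_t for the logits at h + t Dh, which are affine in t with slope
   c y = Dh^T W_out embed(y), and g t for the log-partition function of l_t.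
   Then KL = g'(1) - g(1) + g(0), which is the value at 1 of a function vanishing
   at 0 with derivative t g''(t), and g''(t) is the variance of c under the
   softmax of l_t, that is Dh^T F(h + t Dh) Dh <= Lambda_C |Dh|^2.  The bound
   |Dh| <= eta r_max y_max concludes.  Since the suprema are real-valued, the
   argument also needs that F has a real eigenvalue and that its eigenvalues are
   bounded uniformly in t. *)
Require Import Defs.
From HB Require Import structures.
From mathcomp Require Import all_boot all_order all_algebra.
From mathcomp Require Import all_classical all_reals all_analysis.
From mathcomp Require Import ring lra.

Set Implicit Arguments.
Unset Strict Implicit.
Unset Printing Implicit Defensive.

Import Order.TTheory GRing.Theory Num.Theory.
Import numFieldNormedType.Exports.

Local Open Scope classical_set_scope.
Local Open Scope ring_scope.

(** * Squared Euclidean norms, quadratic forms and real eigenvalues *)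

Local Notation sqn u := (\sum_j u j 0 ^+ 2).

Definition qform (R : realType) (D : nat) (A : 'M[R]_D) (u : 'cV[R]_D) : R :=
  (u^T *m A *m u) 0 0.

Lemma dotmxE (R : realType) (D : nat) (u v : 'cV[R]_D) :
  (u^T *m v) 0 0 = \sum_j u j 0 * v j 0.
Proof. by rewrite mxE; apply: eq_bigr => j _; rewrite !mxE. Qed.

Lemma sqnE (R : realType) (D : nat) (u : 'cV[R]_D) :
  sqn u = (u^T *m u) 0 0.
Proof. by rewrite dotmxE; apply: eq_bigr => j _; rewrite expr2. Qed.

Lemma sqn_ge0 (R : realType) (D : nat) (u : 'cV[R]_D) : 0 <= sqn u.
Proof. by apply: sumr_ge0 => j _; exact: sqr_ge0. Qed.

Lemma sqn_gt0 (R : realType) (D : nat) (u : 'cV[R]_D) : (0 < sqn u) = (u != 0).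
Proof.
rewrite lt0r sqn_ge0 andbT psumr_neq0 => [|j _]; last exact: sqr_ge0.
apply/hasP/idP => [[j _ /=]|u0].
  by apply: contraTneq => ->; rewrite mxE expr0n ltxx.
have [j uj] : exists j, u j 0 != 0.
  apply/existsP; apply: contraNT u0; rewrite negb_exists => /forallP u0.
  by apply/eqP/colP => j; rewrite mxE; apply/eqP; rewrite -[_ == _]negbK u0.
by exists j; rewrite ?mem_index_enum //= lt0r sqrf_eq0 uj sqr_ge0.
Qed.

Lemma sqn_delta_gt0 (R : realType) (D : nat) (j : 'I_D) :
  0 < sqn (delta_mx j 0 : 'cV[R]_D).
Proof.
rewrite sqn_gt0; apply/eqP => /colP /(_ j).
by rewrite !mxE !eqxx => /eqP; rewrite oner_eq0.
Qed.

Lemma qformE (R : realType) (D : nat) (A : 'M[R]_D) (u : 'cV[R]_D) :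
  qform A u = \sum_i \sum_j u i 0 * A i j * u j 0.
Proof.
rewrite /qform mxE exchange_big /=; apply: eq_bigr => j _.
by rewrite !mxE mulr_suml; apply: eq_bigr => i _; rewrite !mxE.
Qed.

(** Each product of two coordinates of [u] is at most [sqn u] in absolute value. The constant is
    crude, but it suffices wherever only finiteness of a bound matters. *)
Lemma normr_qform_le (R : realType) (D : nat) (A : 'M[R]_D) (u : 'cV[R]_D) :
  `|qform A u| <= (\sum_i \sum_j `|A i j|) * sqn u.
Proof.
rewrite qformE mulr_suml.
apply: le_trans (ler_norm_sum _ _ _) _; apply: ler_sum => i _.
rewrite mulr_suml.
apply: le_trans (ler_norm_sum _ _ _) _; apply: ler_sum => j _.
rewrite !normrM mulrAC mulrC ler_wpM2l //.
have ui k : `|u k 0| ^+ 2 <= sqn u.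
  rewrite real_normK ?num_real// (bigD1 k) //= lerDl.
  by apply: sumr_ge0 => l _; exact: sqr_ge0.
have := ui i; have := ui j.
have := sqr_ge0 (`|u i 0| - `|u j 0|); nra.
Qed.

Lemma qform_rank1 (R : realType) (D : nat) (s v : 'cV[R]_D) :
  qform (s *m s^T) v = (v^T *m s) 0 0 ^+ 2.
Proof.
rewrite /qform mulmxA -mulmxA mxE big_ord1 expr2; congr (_ * _).
by rewrite -[s^T *m v]trmxK trmx_mul trmxK mxE.
Qed.

Lemma qform_sum (R : realType) (D : nat) (I : finType) (A : I -> 'M[R]_D)
    (v : 'cV[R]_D) :
  qform (\sum_i A i) v = \sum_i qform (A i) v.
Proof. by rewrite /qform mulmx_sumr mulmx_suml summxE. Qed.

(* The least [M] with [qform A u <= M * |u|^2] for all [u] is an eigenvalue: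
   otherwise [B := A - M%:M] is negative semidefinite and invertible, and
   evaluating it at [K *: v + B^-1 v] with [K] large bounds [qform B v] above
   by [- |v|^2 / K], so that [M] can be decreased. *)
Lemma sym_eigenvalue_ub (R : realType) (D : nat) (A : 'M[R]_D) :
  (0 < D)%N -> A^T = A ->
  exists2 M, eigenvalue A M & forall u, qform A u <= M * sqn u.
Proof.
move=> D0 symA.
pose S := [set c | forall v : 'cV[R]_D, qform A v <= c * sqn v].
pose C := \sum_i \sum_j `|A i j|.
have S0 : S C.
  by move=> v; apply: le_trans (ler_norm _) (normr_qform_le _ _).
(* A basis vector, available because [D] is positive, keeps the infimum of [S] finite. *)
have lbS : lbound S (- C).
  move=> c /(_ (delta_mx (Ordinal D0) 0)) Sc.
  set e : 'cV[R]_D := delta_mx _ _ in Sc.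
  have e0 : 0 < sqn e := sqn_delta_gt0 _ _.
  rewrite -(ler_pM2r e0); apply: le_trans _ Sc.
  have := normr_qform_le A e; rewrite ler_norml => /andP[+ _].
  by rewrite mulNr.
pose M := inf S.
(* The infimum is attained: for [v != 0], every element of [S] lies above the Rayleigh quotient of
   [v], hence so does [M]. *)
have SM : S M.
  move=> v; have [->|v0] := eqVneq v 0.
    by rewrite /qform sqnE !mulmx0 mxE mulr0.
  have v1 : 0 < sqn v by rewrite sqn_gt0.
  rewrite -ler_pdivrMr//; apply: lb_le_inf; first by exists C.
  by move=> c /(_ v); rewrite ler_pdivrMr.
exists M => //.
apply: contrapT => /negP; rewrite /eigenvalue /eigenspace negbK kermx_eq0.
rewrite row_free_unit; set B := A - M%:M => uB.
have symB : B^T = B by rewrite linearB /= symA tr_scalar_mx.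
have qB v : qform B v = qform A v - M * sqn v.
  by rewrite /qform mulmxBr mulmxBl [LHS]mxE [X in _ + X]mxE mul_mx_scalar
    -scalemxAl [X in _ - X]mxE sqnE.
(* The sum bounds the form of [invmx B] and the [1] makes [K] positive. In the expansion below, the
   cross term [2 * K * sqn v] outweighs the form of [invmx B] by at least [K * sqn v]; dividing by
   [K ^+ 2] gives the gain [K^-1]. *)
clearbody B; pose K := 1 + \sum_i \sum_j `|invmx B i j|.
have K0 : 0 < K.
  by rewrite /K ltr_pwDl// sumr_ge0// => i _; rewrite sumr_ge0.
have SMK : S (M - K^-1).
  move=> v; pose w := invmx B *m v.
  have Bw : B *m w = v by rewrite mulKVmx.
  have := SM (K *: v + w); rewrite -subr_le0 -qB.
  have -> : qform B (K *: v + w) =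
      K ^+ 2 * qform B v + 2 * K * sqn v + qform (invmx B) v.
    have e1 : w^T *m B = v^T.
      by rewrite -[w^T *m B]trmxK trmx_mul trmxK symB Bw.
    have -> : qform (invmx B) v = (v^T *m w) 0 0 by rewrite /qform mulmxA.
    have tE : (K *: v + w)^T = K *: v^T + w^T by rewrite linearD linearZ.
    rewrite /qform tE !mulmxDl e1 -!scalemxAl.
    rewrite !mulmxDr -!scalemxAr -[v^T *m B *m w]mulmxA Bw.
    rewrite sqnE; move: (v^T *m B *m v) (v^T *m v) (v^T *m w) => X X' X''.
    rewrite !mxE; ring.
  have : `|qform (invmx B) v| <= K * sqn v.
    apply: le_trans (normr_qform_le _ _) _.
    by rewrite ler_wpM2r ?sqn_ge0// lerDr.
  rewrite ler_norml => /andP[+ _]; rewrite qB.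
  set q := qform A v; set n := sqn v; set q' := qform _ v => h1 h2.
  rewrite mulrBl -(ler_pM2l K0) mulrBr mulVKf ?gt_eqF//.
  rewrite -(ler_pM2l K0); nra.
have := ge_inf (ex_intro _ _ lbS) SMK; rewrite -/M.
by rewrite lerBrDr gerDl leNgt invr_gt0 K0.
Qed.

(** The eigenvalue from [sym_eigenvalue_ub] dominates the form, and [sup] dominates that eigenvalue
    once the spectrum is bounded above; otherwise [sup] would be a default value. *)
Lemma qform_le_lambda_max (R : realType) (D : nat) (A : 'M[R]_D)
    (u : 'cV[R]_D) :
  (0 < D)%N -> A^T = A -> has_ubound [set a | eigenvalue A a] ->
  qform A u <= lambda_max A * sqn u.
Proof.
move=> D0 symA ubA; have [M eigM AM] := sym_eigenvalue_ub D0 symA.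
apply: le_trans (AM u) _; rewrite ler_wpM2r ?sqn_ge0//.
exact: ub_le_sup.
Qed.

Lemma eigenvalue_qform (R : realType) (D : nat) (A : 'M[R]_D) (a : R) :
  eigenvalue A a -> exists2 u : 'cV[R]_D, u != 0 & qform A u = a * sqn u.
Proof.
(* [eigenvalue] refers to row eigenvectors, hence the transpose. *)
case/eigenvalueP => v vA v0; exists v^T.
  by apply: contra v0 => /eqP v0; rewrite -[v]trmxK v0 trmx0.
by rewrite /qform sqnE trmxK vA -scalemxAl mxE.
Qed.

Lemma ubound_eigenvalue (R : realType) (D : nat) (A : 'M[R]_D) (C : R) :
  (forall u, qform A u <= C * sqn u) -> ubound [set a | eigenvalue A a] C.
Proof.
move=> AC a /= /eigenvalue_qform[u u0 qu].
by move: (AC u); rewrite qu ler_pM2r// sqn_gt0.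
Qed.

(** * Derivatives of finite sums and along lines *)

Lemma is_derive_fsum (R : realType) (I : finType) (f : I -> R -> R)
    (df : I -> R) (t : R) :
  (forall i, is_derive t 1 (f i) (df i)) ->
  is_derive t 1 (fun s => \sum_i f i s) (\sum_i df i).
Proof.
move=> fdf; have -> : (fun s => \sum_i f i s) = \sum_i f i.
  by apply/funext => s; rewrite fct_sumE.
by elim/big_ind2 : _ => // [|] *; [exact: is_derive_cst|exact: is_deriveD].
Qed.

(** Both derivatives are limits of the same difference quotient, so directional derivatives reduce
    to one-variable calculus. *)
Lemma is_derive_line (R : realType) (D : nat) (f : 'cV[R]_D -> R)
    (x v : 'cV[R]_D) (df : R) :
  is_derive (0 : R) 1 (fun s => f (x + s *: v)) df -> is_derive x v f df.
Proof.
move=> fdf; have fE : (fun h : R => h^-1 *: ((f \o shift x) (h *: v) - f x)) =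
    (fun h : R => h^-1 *: (((fun s => f (x + s *: v)) \o shift 0) (h *: 1) -
      f (x + 0 *: v))).
  by apply/funext => s /=; rewrite addr0 scale0r addr0 [_ *: 1]mulr1 [_ + x]addrC.
have [fd fv] := fdf; split; first by rewrite /derivable fE.
by rewrite -fv /derive fE.
Qed.

(** * Softmax, its log-partition function and its moments along a line of logits *)

Section softmax.
Context (R : realType) (Y : finType) (y0 : Y).
Implicit Types l c : Y -> R.

Definition softmax l (y : Y) : R := expR (l y) / \sum_y' expR (l y').
Definition lse l : R := ln (\sum_y expR (l y)).
Definition mean l c : R := \sum_y softmax l y * c y.

Lemma sum_expR_gt0 l : 0 < \sum_y expR (l y).
Proof.
rewrite (bigD1 y0) //= ltr_pwDl ?expR_gt0//.
by apply: sumr_ge0 => y _; exact: expR_ge0.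
Qed.

(** Absorbing the normalisation into the exponent makes positivity, logarithms and derivatives of
    [softmax] immediate. *)
Lemma softmaxE l y : softmax l y = expR (l y - lse l).
Proof. by rewrite expRB lnK// posrE sum_expR_gt0. Qed.

Lemma softmax_ge0 l y : 0 <= softmax l y.
Proof. by rewrite softmaxE expR_ge0. Qed.

Lemma sum_softmax l : \sum_y softmax l y = 1.
Proof. by rewrite -mulr_suml divff// gt_eqF// sum_expR_gt0. Qed.

Lemma ln_softmax l y : ln (softmax l y) = l y - lse l.
Proof. by rewrite softmaxE expRK. Qed.

Lemma is_derive_expR_line (a b t : R) :
  is_derive t 1 (fun s => expR (a + s * b)) (b * expR (a + t * b)).
Proof.
have h : is_derive t 1 (cst a + b \*: id : R -> R) (0 + b *: 1).
  exact: is_derive_eq.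
have -> : (fun s => expR (a + s * b)) = expR \o (cst a + b \*: id : R -> R).
  by apply/funext => s /=; rewrite /= mulrC.
apply: is_derive_eq; rewrite add0r [_ *: 1]mulr1 mulrC.
by rewrite [t * b]mulrC.
Qed.

Lemma is_derive_lse l c (t : R) :
  is_derive t 1 (fun s => lse (fun y => l y + s * c y))
    (mean (fun y => l y + t * c y) c).
Proof.
have hZ := @is_derive_fsum R Y _ _ t (fun y => is_derive_expR_line (l y) (c y) t).
have hl := @is_derive1_ln R _ (sum_expR_gt0 (fun y => l y + t * c y)).
apply: is_derive_eq (is_derive1_comp hl hZ) _.
rewrite /mean mulr_sumr; apply: eq_bigr => y _.
by rewrite /softmax; ring.
Qed.

Lemma is_derive_softmax l c (t : R) y :
  is_derive t 1 (fun s => softmax (fun y => l y + s * c y) y)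
    (softmax (fun y => l y + t * c y) y *
     (c y - mean (fun y => l y + t * c y) c)).
Proof.
have h : is_derive t 1
    ((cst (l y) + c y \*: id : R -> R) - (fun s => lse (fun y => l y + s * c y)))
    (0 + c y *: 1 - mean (fun y => l y + t * c y) c).
  by apply: is_deriveB; exact: is_derive_lse.
have -> : (fun s => softmax (fun y => l y + s * c y) y) = expR \o
    ((cst (l y) + c y \*: id : R -> R) - (fun s => lse (fun y => l y + s * c y))).
  by apply/funext => s /=; rewrite softmaxE /= [s * _]mulrC.
apply: is_derive_eq; rewrite add0r [_ *: 1]mulr1 softmaxE; congr (expR _ * _).
by rewrite [t * c y]mulrC.
Qed.

Definition variance l c : R := \sum_y softmax l y * (c y - mean l c) ^+ 2.

Lemma varianceE l c :
  variance l c = \sum_y softmax l y * c y ^+ 2 - mean l c ^+ 2.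
Proof.
set m := mean l c.
have -> : variance l c = \sum_y (softmax l y * c y ^+ 2
    - (2 * m) * (softmax l y * c y) + m ^+ 2 * softmax l y).
  by apply: eq_bigr => y _; rewrite -/m; ring.
rewrite big_split /= sumrB -!mulr_sumr sum_softmax -/(mean l c) -/m; ring.
Qed.

(** Differentiating the weights gives the mean of [c * (c - m)], where [m] is the mean of [c]; this
    is the second moment minus [m ^+ 2]. *)
Lemma is_derive_mean l c (t : R) :
  is_derive t 1 (fun s => mean (fun y => l y + s * c y) c)
    (variance (fun y => l y + t * c y) c).
Proof.
have h y : is_derive t 1 (c y \*: fun s => softmax (fun y => l y + s * c y) y)
    (c y *: (softmax (fun y => l y + t * c y) y *
     (c y - mean (fun y => l y + t * c y) c))).
  by apply: is_deriveZ; exact: is_derive_softmax.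
have := is_derive_fsum h.
have -> : (fun s => \sum_i (c i \*: (fun s0 : R => softmax (fun y => l y + s0 * c y) i)) s)
   = (fun s => mean (fun y => l y + s * c y) c).
  apply/funext => s; apply: eq_bigr => y _ /=; exact: mulrC.
move=> hm; apply: is_derive_eq hm _.
rewrite varianceE expr2 [X in _ * X]/mean mulr_sumr -sumrB; apply: eq_bigr => y _.
rewrite /GRing.scale /=; ring.
Qed.

Lemma KL_softmax_le l c (L : R) :
  (forall t : R, 0 <= t <= 1 -> variance (fun y => l y + t * c y) c <= L) ->
  KL (softmax (fun y => l y + c y)) (softmax l) <= 1 / 2 * L.
Proof.
move=> varL.
pose lc t := fun y => l y + t * c y.
have lc0 : lc 0 = l by apply/funext => y; rewrite /lc mul0r addr0.
have lc1 : lc 1 = (fun y => l y + c y).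
  by apply/funext => y; rewrite /lc mul1r.
have KLE : KL (softmax (fun y => l y + c y)) (softmax l) =
    mean (lc 1) c - lse (lc 1) + lse l.
  rewrite -lc1 /KL.
  under eq_bigr => y _.
    rewrite ln_div ?posrE; [|by rewrite softmaxE expR_gt0..].
    rewrite !ln_softmax {2}lc1.
    have -> : softmax (lc 1) y * (l y + c y - lse (lc 1) - (l y - lse l)) =
      softmax (lc 1) y * c y + softmax (lc 1) y * (lse l - lse (lc 1)) by ring.
    over.
  by rewrite big_split /= -mulr_suml sum_softmax -/(mean _ _); ring.
(* With [g t = lse (lc t)], this is [t g'(t) - g(t) - L t^2 / 2]. Its increment over the unit
   interval is the divergence minus [L / 2], and its derivative [t (g''(t) - L)] is nonpositive
   there, so the mean value theorem replaces integration. *)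
pose phi : R -> R := (id * (fun t => mean (lc t) c)) - (fun t => lse (lc t))
  - (L / 2) \*: (id * id : R -> R).
have dphi (t : R) : is_derive t 1 phi (t * (variance (lc t) c - L)).
  have h1 := is_derive_lse l c t; have h2 := is_derive_mean l c t.
  apply: is_derive_eq.
  by rewrite /GRing.scale /=; field.
have [] := @MVT R phi _ 0 1 ltr01 (fun t _ => dphi t).
  by apply: derivable_within_continuous => t _; exact: ex_derive.
move=> t; rewrite in_itv /= => /andP[t0 t1].
have /varL : 0 <= t <= 1 by rewrite !ltW.
rewrite -/(lc t) => vL.
rewrite subr0 mulr1 /phi /= !fctE /= lc0 KLE /GRing.scale /= => e.
have : t * (variance (lc t) c - L) <= 0.
  by rewrite mulr_ge0_le0 ?subr_le0// ltW.
rewrite -e; lra.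
Qed.

End softmax.

(** * The score and the Fisher information of the policy *)

Section policy.
Context (R : realType) (D : nat) (Y : finType) (y0 : Y).
Context (W : 'M[R]_D) (embed : Y -> 'cV[R]_D).
Implicit Types x v : 'cV[R]_D.

Local Notation score x y :=
  (gradient (fun x' => ln (policy W embed x' y)) x).

Lemma logit_line x v (t : R) :
  logit W embed (x + t *: v) =
  (fun y => logit W embed x y + t * logit W embed v y).
Proof.
apply/funext => y.
have tE : (x + t *: v)^T = x^T + t *: v^T by rewrite linearD linearZ.
by rewrite /logit tE !mulmxDl -!scalemxAl mxE [X in _ + X]mxE.
Qed.

Lemma logitE v y : logit W embed v y = \sum_j v j 0 * (W *m embed y) j 0.
Proof. by rewrite /logit -mulmxA dotmxE. Qed.

(** The logits are linear in the hidden state with gradient [W *m embed y], and the gradient of the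
    log-partition function is the mean of these vectors. *)
Lemma scoreE x y :
  score x y = W *m embed y - \sum_y' policy W embed x y' *: (W *m embed y').
Proof.
apply/colP => j; rewrite mxE.
have dlog v : is_derive x v (fun x' => ln (policy W embed x' y))
    (logit W embed v y - mean (logit W embed x) (logit W embed v)).
  apply: is_derive_line.
  have -> : (fun s : R => ln (policy W embed (x + s *: v) y)) =
      (cst (logit W embed x y) + logit W embed v y \*: id : R -> R) -
      (fun s => lse (fun y => logit W embed x y + s * logit W embed v y)).
    (* [policy] unfolds to [softmax] of the logits; [y] itself witnesses that [Y] is nonempty. *)
    apply/funext => s; rewrite [LHS](ln_softmax y) logit_line.
    by rewrite /= !fctE /= /GRing.scale /= [s * _]mulrC.
  have hl := is_derive_lse y (logit W embed x) (logit W embed v) 0.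
  apply: is_derive_eq; rewrite add0r [_ *: 1]mulr1; congr (_ - mean _ _).
  by apply/funext => y'; rewrite mul0r addr0.
have logit_delta z : logit W embed (delta_mx j 0) z = (W *m embed z) j 0.
  rewrite logitE (bigD1 j) //= mxE !eqxx mul1r big1 ?addr0// => i /negPf ij.
  by rewrite mxE ij mul0r.
rewrite derive_val logit_delta [RHS]mxE; congr (_ + _).
rewrite mxE summxE; congr (- _); apply: eq_bigr => z _.
by rewrite logit_delta [RHS]mxE.
Qed.

(** By [scoreE], pairing the score with [v] gives the centred logit of [v], whose mean square is a
    variance. *)
Lemma qform_fisher x v :
  qform (fisher W embed x) v = variance (logit W embed x) (logit W embed v).
Proof.
rewrite /fisher qform_sum; apply: eq_bigr => y _.
transitivity (policy W embed x y * qform (score x y *m (score x y)^T) v).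
  by rewrite /qform -scalemxAr -scalemxAl mxE.
rewrite qform_rank1; congr (_ * _ ^+ 2).
rewrite scoreE mulmxBr mulmx_sumr mxE; congr (_ + _).
  by rewrite /logit mulmxA.
rewrite mxE summxE; congr (- _); apply: eq_bigr => z _.
by rewrite -scalemxAr mxE /logit !mulmxA.
Qed.

Lemma fisher_sym x : (fisher W embed x)^T = fisher W embed x.
Proof.
rewrite /fisher raddf_sum /=; apply: eq_bigr => y _.
by rewrite linearZ /= trmx_mul trmxK.
Qed.

(** A variance is at most the second moment, and softmax weights are at most 1. The resulting sum of
    squared logits of [v] is the form of a matrix independent of [x], whence a uniform [K]. *)
Lemma qform_fisher_le :
  exists K, forall x v, qform (fisher W embed x) v <= K * sqn v.
Proof.
pose A := \sum_y (W *m embed y) *m (W *m embed y)^T.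
exists (\sum_i \sum_j `|A i j|) => x v; rewrite qform_fisher.
apply: le_trans (le_trans (ler_norm _) (normr_qform_le A v)).
have -> : qform A v = \sum_y logit W embed v y ^+ 2.
  rewrite qform_sum; apply: eq_bigr => y _.
  by rewrite qform_rank1 /logit mulmxA.
rewrite (varianceE y0) -[leRHS]subr0; apply: lerB; last exact: sqr_ge0.
apply: ler_sum => y _; rewrite ler_piMl ?sqr_ge0//.
rewrite -(sum_softmax y0 (logit W embed x)) [leRHS](bigD1 y) //= lerDl.
by apply: sumr_ge0 => z _; exact: softmax_ge0.
Qed.

End policy.

(** * The size of the hidden-state update *)

Lemma sqn_scale_sum_le (R : realType) (D N : nat) (a r_max y_max : R)
    (r : 'I_N -> R) (y : 'I_N -> 'cV[R]_D) :
  (0 < N)%N -> (forall i, `|r i| <= r_max) -> (forall i, enorm (y i) <= y_max) ->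
  sqn ((a / N%:R) *: \sum_(i < N) r i *: y i) <= (a * r_max * y_max) ^+ 2.
Proof.
move=> N0 r_le y_le.
have sq_le i : r i ^+ 2 * sqn (y i) <= (r_max * y_max) ^+ 2.
  rewrite exprMn ler_pM ?sqr_ge0 ?sqn_ge0//.
    rewrite -[r i ^+ 2]real_normK ?num_real// ler_sqr ?nnegrE//.
    exact: le_trans (r_le i).
  have y0 : 0 <= enorm (y i) by exact: sqrtr_ge0.
  rewrite -(@sqr_sqrtr _ (sqn (y i))) ?sqn_ge0// -/(enorm _).
  by rewrite ler_sqr ?nnegrE// (le_trans y0).
have jensen (b : 'I_N -> R) :
    (\sum_i b i) ^+ 2 <= N%:R * \sum_i b i ^+ 2.
  rewrite expr2 mulr_suml.
  (* As double sums, the two sides compare termwise through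
     [b i * b j <= (b i ^+ 2 + b j ^+ 2) / 2]. *)
  have -> : N%:R * \sum_i b i ^+ 2 =
      \sum_i \sum_j (b i ^+ 2 + b j ^+ 2) / 2.
    under [RHS]eq_bigr => i _ do rewrite -mulr_suml big_split /= sumr_const card_ord.
    rewrite -mulr_suml big_split /= sumr_const card_ord sumrMnl.
    by rewrite -[_ *+ N]mulr_natl; move: (\sum_i _) => q; field.
  apply: ler_sum => i _; rewrite mulr_sumr; apply: ler_sum => j _.
  have := sqr_ge0 (b i - b j); lra.
have Nr0 : 0 < N%:R :> R by rewrite ltr0n.
(* One factor [N] comes from [jensen] in each coordinate, the other from adding [N] equal bounds;
   together they cancel the square of [1 / N]. *)
have sum_le : sqn (\sum_(i < N) r i *: y i) <= N%:R ^+ 2 * (r_max * y_max) ^+ 2.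
  apply: (@le_trans _ _ (\sum_j N%:R * \sum_i (r i * y i j 0) ^+ 2)).
    apply: ler_sum => j _; rewrite summxE.
    by under eq_bigr => i _ do rewrite mxE; exact: jensen.
  rewrite -mulr_sumr expr2 -mulrA ler_pM2l// exchange_big /=.
  apply: (@le_trans _ _ (\sum_(i < N) (r_max * y_max) ^+ 2)).
    apply: ler_sum => i _; apply: le_trans (sq_le i).
    by rewrite mulr_sumr; apply: ler_sum => j _; rewrite exprMn.
  by rewrite sumr_const card_ord mulr_natl.
have -> : sqn ((a / N%:R) *: \sum_(i < N) r i *: y i) =
    (a / N%:R) ^+ 2 * sqn (\sum_(i < N) r i *: y i).
  by rewrite mulr_sumr; apply: eq_bigr => j _; rewrite mxE exprMn.
apply: le_trans (ler_wpM2l (sqr_ge0 _) sum_le) _.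
by rewrite -exprMn -exprMn mulrA divfK ?gt_eqF// mulrA.
Qed.

Theorem theorem3p6 (R : realType) (D N : nat) (hD : (0 < D)%N) (hN : (0 < N)%N)
    (eta : R) (heta : 0 < eta)
    (Y : finType) (hY : (0 < #|Y|)%N)
    (embed : Y -> 'cV[R]_D) (W_out : 'M[R]_D)
    (example : 'I_N -> Y) (r : 'I_N -> R) (h : 'cV[R]_D) :
  let ys := fun i : 'I_N => embed (example i) in
  let Dh := (eta / N%:R) *: \sum_(i < N) r i *: ys i in
  let pi_ref := policy W_out embed h in
  let pi_ICL := policy W_out embed (h + Dh) in
  let Lambda_C :=
    sup [set lambda_max (fisher W_out embed (h + t *: Dh)) | t in `[0, 1]] in
  let r_max := \big[Num.max/0]_(i < N) `|r i| in
  let y_max := \big[Num.max/0]_(i < N) enorm (ys i) in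
  KL pi_ICL pi_ref <= 1 / 2 * Lambda_C * (eta * r_max * y_max) ^+ 2.
Proof.
pose ys i := embed (example i).
pose Dh := (eta / N%:R) *: \sum_(i < N) r i *: ys i.
pose pi_ref := policy W_out embed h.
pose pi_ICL := policy W_out embed (h + Dh).
pose F t := fisher W_out embed (h + t *: Dh).
pose Lambda_C := sup [set lambda_max (F t) | t in `[0, 1]].
pose r_max := \big[Num.max/0]_(i < N) `|r i|.
pose y_max := \big[Num.max/0]_(i < N) enorm (ys i).
change (KL pi_ICL pi_ref <= 1 / 2 * Lambda_C * (eta * r_max * y_max) ^+ 2).
have /card_gt0P[y0 _] := hY.
have [K hK] := qform_fisher_le y0 W_out embed.
have eig_le x : ubound [set a | eigenvalue (fisher W_out embed x) a] K.
  exact/ubound_eigenvalue/hK.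
have lambda_le t v : qform (F t) v <= lambda_max (F t) * sqn v.
  apply: qform_le_lambda_max => //; first exact: fisher_sym.
  by exists K; exact: eig_le.
have Lambda_ub t : 0 <= t <= 1 -> lambda_max (F t) <= Lambda_C.
  move=> t01; apply: ub_le_sup; last by exists t => //=; rewrite in_itv.
  (* The bound [K] is uniform in the time parameter; passing it to [lambda_max] requires a nonempty
     spectrum, supplied by [sym_eigenvalue_ub]. *)
  exists K => _ [s _ <-]; apply: ge_sup; last exact: eig_le.
  have [M eigM _] := sym_eigenvalue_ub hD (fisher_sym W_out embed (h + s *: Dh)).
  by exists M.
have sqnDh : sqn Dh <= (eta * r_max * y_max) ^+ 2.
  (* Since [N] is positive and the terms are nonnegative, starting the maxima at [0] does not alter
     them. *)
  apply: sqn_scale_sum_le => // i; first exact: (le_bigmax _ (fun i => `|r i|)).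
  exact: (le_bigmax _ (fun i => enorm (ys i))).
(* This sign is what allows [sqn Dh] to be replaced by its upper bound at the end. It is read off
   from a basis vector, where the Fisher form is a variance. *)
have Lambda_ge0 : 0 <= Lambda_C.
  apply: le_trans (Lambda_ub 0 _); last by rewrite lexx ler01.
  have e0 := sqn_delta_gt0 R (Ordinal hD).
  rewrite -(pmulr_lge0 _ e0); apply: le_trans (lambda_le 0 _).
  rewrite qform_fisher//; apply: sumr_ge0 => y _.
  by rewrite mulr_ge0 ?sqr_ge0//; exact: softmax_ge0.
have KL_le : KL pi_ICL pi_ref <= 1 / 2 * (Lambda_C * sqn Dh).
  have -> : pi_ICL =
      softmax (fun y => logit W_out embed h y + logit W_out embed Dh y).
    have := logit_line W_out embed h Dh 1; rewrite scale1r => hE.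
    rewrite /pi_ICL /policy hE; apply/funext => y; rewrite /softmax mul1r.
    by congr (_ / _); apply: eq_bigr => y' _; rewrite mul1r.
  apply: KL_softmax_le => // t t01.
  rewrite -logit_line -qform_fisher//; apply: le_trans (lambda_le t Dh) _.
  by rewrite ler_wpM2r ?sqn_ge0// Lambda_ub.
apply: le_trans KL_le _; rewrite mulrA ler_wpM2l// mulr_ge0//.
Qed.
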